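(* Let $m,n,r\ge1$. Let $B\in\mathbb R_{\ge0}^{m\times(mn)}$, with columns indexed by $(i,j)\in[m]\times[n]$, be a block diagonal matrix where each block consists of a single row, i.e. $B_{i,(i',j)}=0$ whenever $i\ne i'$. Let $g=(g_{i,j})_{(i,j)\in[m]\times[n]}:\mathbb R^r\to\mathbb R_{\ge0}^{mn}$ be an arbitrary nonnegative function. Consider the program $$\inf_{x\in\mathcal X}u^TBg(x)\qquad(\mathrm P)$$ under interval uncertainty $u_i\in\mathcal U^i:=[\overline u_i,\overline u_i+\Delta u_i]\subseteq\mathbb R_{\ge0}$ for all $i\in[m]$, and assume that $$\mathcal X\subseteq\{x\in\mathbb R^r:\ \forall i\in[m]\ \exists!\,j\in[n]:\ g_{i,j}(x)\neq0\}.$$ Let $\Gamma\in[m]$. Then the $\Gamma$-counterpart of $(\mathrm P)$ and the $\Gamma$-counterpart of the program $$\inf_{x\in\mathcal X}y^Tg(x)\qquad(\mathrm P')$$ under interval uncertainty $y_{(i,j)}\in\mathcal Y^{(i,j)}:=[\overline u_iB_{i,(i,j)},(\overline u_i+\Delta u_i)B_{i,(i,j)}]$ for all $(i,j)\in[m]\times[n]$ are equivalent.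
   Context: Notation: $[m]:=\{1,\dots,m\}$. $\Gamma$-counterpart: given a finite index set $I$, uncertainty sets $\mathcal U_i$ with nominal scenarios $\overline u^i\in\mathcal U_i$ and functions $f_i(x,u^i)$ for $i\in I$, the $\Gamma$-counterpart of $\inf_{x\in\mathcal X}\sum_{i\in I}f_i(x,\overline u^i)$ is $$\inf_{x\in\mathcal X}\ \sup_{\mathcal S\subseteq I:|\mathcal S|\le\Gamma}\Big\{\sum_{i\in\mathcal S}\sup_{u^i\in\mathcal U_i}f_i(x,u^i)+\sum_{i\in I\setminus\mathcal S}f_i(x,\overline u^i)\Big\}.$$ For $(\mathrm P)$ one takes $I=[m]$ and $f_i(x,u_i)=u_i\,B_{i,\cdot}\,g(x)$ with nominal value $\overline u_i$, where $B_{i,\cdot}$ is the $i$-th row of $B$. For $(\mathrm P')$ one takes $I=[m]\times[n]$ and $f_{(i,j)}(x,y_{(i,j)})=y_{(i,j)}g_{i,j}(x)$ with nominal value $\overline y_{(i,j)}=\overline u_iB_{i,(i,j)}$. Two minimization programs in $x$ (possibly with further auxiliary variables or indices) are called equivalent if they have the same optimal value in $[-\infty,\infty]$ and, whenever this value is finite, a point $x\in\mathcal X$ attains it in one program (for a suitable choice of the auxiliary variables or indices) if and only if it does so in the other. *)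

(* Defs.v *)
From HB Require Import structures.
From mathcomp Require Import all_boot all_order all_algebra.
From mathcomp Require Import all_classical all_reals all_analysis.

Set Implicit Arguments.
Unset Strict Implicit.
Unset Printing Implicit Defensive.

Import Order.TTheory GRing.Theory Num.Theory.

Local Open Scope classical_set_scope.
Local Open Scope ring_scope.

Record min_program (R : realType) (T : Type) := MinProgram {
  mp_feasible : set T;
  mp_objective : T -> \bar R }.

Definition optimal_value (R : realType) (T : Type) (Q : min_program R T) :
    \bar R :=
  ereal_inf [set mp_objective Q x | x in mp_feasible Q].

Definition attains (R : realType) (T : Type) (Q : min_program R T) (x : T) :
    Prop :=
  mp_feasible Q x /\ mp_objective Q x = optimal_value Q.

(* Both programs range over [x : T] only, so there are no auxiliary variables
   to quantify over in the attainment condition. *)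
Definition equivalent (R : realType) (T : Type) (Q Q' : min_program R T) :
    Prop :=
  optimal_value Q = optimal_value Q' /\
  (optimal_value Q \is a fin_num ->
   forall x : T, attains Q x <-> attains Q' x).

(* inf over x in X of the sum over i : I of f_i(x, u^i), where the scenario
   u^i : V i is uncertain in U_i and has a nominal value. *)
Record uncertain_program (R : realType) (T : Type) (I : finType)
    (V : I -> Type) := UncertainProgram {
  up_feasible : set T;
  up_uncertainty : forall i : I, set (V i);
  up_nominal : forall i : I, V i;
  up_term : forall i : I, T -> V i -> R }.

Arguments up_uncertainty {R T I V} _ i.
Arguments up_nominal {R T I V} _ i.
Arguments up_term {R T I V} _ i x v.

(* Since the [up_term] are real-valued, the suprema over nonempty uncertainty
   sets are never -oo, so the sums in [\bar R] below are unambiguous. *)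
Definition gamma_objective (R : realType) (T : Type) (I : finType)
    (V : I -> Type) (Gamma : nat) (P : uncertain_program R T V) (x : T) :
    \bar R :=
  ereal_sup
    [set (\sum_(i in S)
            ereal_sup [set (up_term P i x v)%:E | v in up_uncertainty P i]
          + \sum_(i in ~: S) (up_term P i x (up_nominal P i))%:E)%E
    | S in [set S : {set I} | (#|S| <= Gamma)%N]].

Definition gamma_counterpart (R : realType) (T : Type) (I : finType)
    (V : I -> Type) (Gamma : nat) (P : uncertain_program R T V) :
    min_program R T :=
  MinProgram (up_feasible P) (gamma_objective Gamma P).

(* The coordinates of R^(mn) are indexed by pairs (i, j) through
   [mxvec_index : 'I_m -> 'I_n -> 'I_(m * n)], which is a bijection. *)

Definition block_diagonal_rows (R : realType) (m n : nat)
    (B : 'M[R]_(m, m * n)) : Prop :=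
  forall (i i' : 'I_m) (j : 'I_n), i != i' -> B i (mxvec_index i' j) = 0.

Definition cost_interval (R : realType) (m : nat) (u du : 'cV[R]_m)
    (i : 'I_m) : set R :=
  `[u i 0, u i 0 + du i 0]%classic.

Definition program_P (R : realType) (m n r : nat) (X : set 'cV[R]_r)
    (B : 'M[R]_(m, m * n)) (g : 'cV[R]_r -> 'cV[R]_(m * n))
    (u du : 'cV[R]_m) :
    uncertain_program R 'cV[R]_r (fun _ : 'I_m => R) :=
  @UncertainProgram R 'cV[R]_r 'I_m (fun _ => R) X
    (cost_interval u du)
    (fun i => u i 0)
    (fun i x ui => ui * (row i B *m g x) 0 0).

Definition program_P' (R : realType) (m n r : nat) (X : set 'cV[R]_r)
    (B : 'M[R]_(m, m * n)) (g : 'cV[R]_r -> 'cV[R]_(m * n))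
    (u du : 'cV[R]_m) :
    uncertain_program R 'cV[R]_r (fun _ : 'I_m * 'I_n => R) :=
  @UncertainProgram R 'cV[R]_r ('I_m * 'I_n)%type (fun _ => R) X
    (fun p => `[u p.1 0 * B p.1 (mxvec_index p.1 p.2),
                (u p.1 0 + du p.1 0) * B p.1 (mxvec_index p.1 p.2)]%classic)
    (fun p => u p.1 0 * B p.1 (mxvec_index p.1 p.2))
    (fun p x y => y * g x (mxvec_index p.1 p.2) 0).

Lemma sum_term_P (R : realType) (m n r : nat) (X : set 'cV[R]_r)
    (B : 'M[R]_(m, m * n)) (g : 'cV[R]_r -> 'cV[R]_(m * n))
    (u du v : 'cV[R]_m) (x : 'cV[R]_r) :
  \sum_(i < m) up_term (program_P X B g u du) i x (v i 0) =
  (v^T *m B *m g x) 0 0.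
Proof.
rewrite -mulmxA mxE; apply: eq_bigr => i _ /=.
by rewrite -row_mul !mxE.
Qed.

Lemma sum_term_P' (R : realType) (m n r : nat) (X : set 'cV[R]_r)
    (B : 'M[R]_(m, m * n)) (g : 'cV[R]_r -> 'cV[R]_(m * n))
    (u du : 'cV[R]_m) (y : 'cV[R]_(m * n)) (x : 'cV[R]_r) :
  \sum_(p : 'I_m * 'I_n)
     up_term (program_P' X B g u du) p x (y (mxvec_index p.1 p.2) 0) =
  (y^T *m g x) 0 0.
Proof.
rewrite mxE [RHS](reindex _ (curry_mxvec_bij m n)) /=.
by apply: eq_bigr => -[i j] _ /=; rewrite mxE.
Qed.

(* Main.v *)
Require Import Defs.
From HB Require Import structures.
From mathcomp Require Import all_boot all_order all_algebra.
From mathcomp Require Import all_classical all_reals all_analysis.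

Set Implicit Arguments.
Unset Strict Implicit.
Unset Printing Implicit Defensive.

Import Order.TTheory GRing.Theory Num.Theory.

Local Open Scope classical_set_scope.
Local Open Scope ring_scope.

(** The two counterparts have the same objective at every feasible point.  At
    [x] in [X], row [i] has exactly one active column [J i], the one with
    [g_{i, J i}(x) != 0].  Every other coefficient [(i, j)] of the second program
    contributes [0], whether it takes its nominal or its worst value, so an
    adversary gains nothing by perturbing it; and because [B] is block
    diagonal, the term of [(i, J i)] has the nominal and the worst value of the
    term of [i] in the first program: both are linear in the uncertain
    parameter, and since the coefficients are nonnegative the worst value is
    reached at the upper end of the interval.

    Hence the injection [i |-> (i, J i)] translates the adversary's choices:
    the image of a set of at most [Gamma] rows has at most [Gamma] elements,
    so does the preimage of a set of at most [Gamma] pairs, and neither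
    translation changes the cost.  This is [gamma_objective_embed]; the injection depends on [x], which is harmless
    since the objectives are compared one point at a time. *)

Lemma equivalent_eq_objective (R : realType) (T : Type) (X : set T)
    (f f' : T -> \bar R) :
  {in X, f =1 f'} -> equivalent (MinProgram X f) (MinProgram X f').
Proof.
move=> ff'.
have eq_opt : optimal_value (MinProgram X f) = optimal_value (MinProgram X f').
  by congr ereal_inf; apply: eq_imagel => x Xx; apply/ff'/mem_set.
split=> // _ x; rewrite /attains -eq_opt /=.
by split=> -[Xx fx]; split=> //; rewrite -fx ff' //; apply/mem_set.
Qed.

Definition worst_term (R : realType) (T : Type) (I : finType) (V : I -> Type)
    (P : uncertain_program R T V) (i : I) (x : T) : \bar R :=
  ereal_sup [set (up_term P i x v)%:E | v in up_uncertainty P i].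

Definition nominal_term (R : realType) (T : Type) (I : finType) (V : I -> Type)
    (P : uncertain_program R T V) (i : I) (x : T) : \bar R :=
  (up_term P i x (up_nominal P i))%:E.

Definition scenario_cost (R : realType) (I : finType) (w c : I -> \bar R)
    (S : {set I}) : \bar R :=
  (\sum_(i in S) w i + \sum_(i in ~: S) c i)%E.

(** Indices outside the image of [h] cost [0] whether or not they are
    perturbed, so a set of [I'] matters only through its preimage. *)
Lemma scenario_cost_preim (R : realType) (I I' : finType) (h : I -> I')
    (w c : I -> \bar R) (w' c' : I' -> \bar R) (S : {set I'}) :
  injective h ->
  w' \o h =1 w -> c' \o h =1 c ->
  (forall k, k \notin codom h -> w' k = 0%E /\ c' k = 0%E) ->
  scenario_cost w' c' S = scenario_cost w c (h @^-1: S).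
Proof.
move=> h_inj eqw eqc off.
have sum_codom (A : {set I'}) (F : I' -> \bar R) :
    (forall k, k \notin codom h -> F k = 0%E) ->
    (\sum_(k in A) F k = \sum_(i in h @^-1: A) F (h i))%E.
  move=> F0; rewrite (bigID (mem (codom h))) /=.
  rewrite [X in (_ + X)%E]big1 ?adde0; last by move=> k /andP[_ /F0].
  rewrite -(big_imset F (A := mem (h @^-1: A))); last by move=> i j _ _ /h_inj.
  apply: eq_bigl => k; apply/andP/imsetP => [[kA /codomP[i ki]]|[i]].
    by exists i => //; rewrite inE -ki.
  by rewrite inE => hiA ->; rewrite codom_f.
rewrite /scenario_cost !sum_codom ?preimsetC; last 2 first.
- by move=> k /off[].
- by move=> k /off[].
by congr (_ + _)%E; apply: eq_bigr => i _; [exact: eqw | exact: eqc].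
Qed.

(** Images and preimages under an injection do not increase cardinality, so
    the budget [Gamma] survives both translations, and the two suprema run
    over the same set of costs. *)
Lemma gamma_objective_embed (R : realType) (T : Type) (I I' : finType)
    (V : I -> Type) (V' : I' -> Type) (Gamma : nat)
    (P : uncertain_program R T V) (P' : uncertain_program R T V')
    (h : I -> I') (x : T) :
  injective h ->
  (forall i, worst_term P' (h i) x = worst_term P i x) ->
  (forall i, nominal_term P' (h i) x = nominal_term P i x) ->
  (forall k, k \notin codom h ->
     worst_term P' k x = 0%E /\ nominal_term P' k x = 0%E) ->
  gamma_objective Gamma P x = gamma_objective Gamma P' x.
Proof.
move=> h_inj eqw eqc off.
have cost_preim S := scenario_cost_preim S h_inj eqw eqc off.
congr ereal_sup; apply/seteqP; split=> _ [S /= S_le <-].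
- exists (h @: S); first exact: leq_trans (leq_imset_card _ _) S_le.
  rewrite [LHS]cost_preim; congr scenario_cost.
  by apply/setP => i; rewrite inE mem_imset.
- exists (h @^-1: S); last by rewrite [RHS]cost_preim.
  apply: leq_trans S_le; rewrite -(card_imset _ h_inj).
  by apply/subset_leq_card/fintype.subsetP => _ /imsetP[i + ->]; rewrite inE.
Qed.

Lemma ereal_sup_itvcc_mulr (R : realType) (a b c : R) :
  a <= b -> 0 <= c ->
  ereal_sup [set (v * c)%:E | v in `[a, b]] = (b * c)%:E.
Proof.
move=> ab c0; apply/eqP; rewrite eq_le; apply/andP; split.
  apply: ge_ereal_sup => _ [v /= + <-]; rewrite in_itv /= => /andP[_ vb].
  by rewrite lee_fin ler_wpM2r.
by apply: ereal_sup_ubound; exists b => //=; rewrite in_itv /= ab lexx.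
Qed.

(** The block structure leaves the columns [(i, j)] of row [i], and of these
    only the active one survives. *)
Lemma row_mulmx_active (R : realType) (m n : nat) (B : 'M[R]_(m, m * n))
    (z : 'cV[R]_(m * n)) (i : 'I_m) (j : 'I_n) :
  block_diagonal_rows B ->
  (forall j', j' != j -> z (mxvec_index i j') 0 = 0) ->
  (row i B *m z) 0 0 = B i (mxvec_index i j) * z (mxvec_index i j) 0.
Proof.
move=> hB z0; rewrite mxE (reindex _ (curry_mxvec_bij m n)) /=.
rewrite (bigD1 (i, j)) //= mxE big1 ?addr0 // => -[i' j'] /=.
rewrite mxE; have [<- ne_ij|ne_i _] := eqVneq i i'; last by rewrite hB ?mul0r.
by rewrite z0 ?mulr0 //; apply: contraNneq ne_ij => ->.
Qed.

Theorem theorem3p11 (R : realType) (m n r : nat)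
    (hm : (1 <= m)%N) (hn : (1 <= n)%N) (hr : (1 <= r)%N)
    (B : 'M[R]_(m, m * n))
    (hB0 : forall (i : 'I_m) (k : 'I_(m * n)), 0 <= B i k)
    (hB : block_diagonal_rows B)
    (g : 'cV[R]_r -> 'cV[R]_(m * n))
    (hg : forall (x : 'cV[R]_r) (k : 'I_(m * n)), 0 <= g x k 0)
    (u du : 'cV[R]_m)
    (hnom : forall i : 'I_m, cost_interval u du i (u i 0))
    (hU : forall i : 'I_m, cost_interval u du i `<=` [set t : R | 0 <= t])
    (X : set 'cV[R]_r)
    (hX : X `<=` [set x : 'cV[R]_r | forall i : 'I_m,
                    exists! j : 'I_n, g x (mxvec_index i j) 0 != 0])
    (Gamma : nat) (hGamma : (1 <= Gamma <= m)%N) :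
  equivalent (gamma_counterpart Gamma (program_P X B g u du))
             (gamma_counterpart Gamma (program_P' X B g u du)).
Proof.
apply: equivalent_eq_objective => x /set_mem Xx.
have /choice[J J_uniq] := hX x Xx.
have inactive i j : j != J i -> g x (mxvec_index i j) 0 = 0.
  by move=> /eqP jJ; apply: contrapT => /eqP /(J_uniq i).2 /esym.
have du0 i : u i 0 <= u i 0 + du i 0.
  by have := hnom i; rewrite /cost_interval /= in_itv /= => /andP[].
have row_active i :
    (row i B *m g x) 0 0 =
    B i (mxvec_index i (J i)) * g x (mxvec_index i (J i)) 0.
  by apply: row_mulmx_active => // j; exact: inactive.
have worstP i : worst_term (program_P X B g u du) i x =
    ((u i 0 + du i 0) * (row i B *m g x) 0 0)%:E.
  by rewrite /worst_term ereal_sup_itvcc_mulr // row_active mulr_ge0.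
have worstP' p : worst_term (program_P' X B g u du) p x =
    ((u p.1 0 + du p.1 0) * B p.1 (mxvec_index p.1 p.2)
     * g x (mxvec_index p.1 p.2) 0)%:E.
  by rewrite /worst_term ereal_sup_itvcc_mulr // ler_wpM2r.
have graph_inj : injective (fun i => (i, J i)) by move=> i i' [].
apply: (gamma_objective_embed _ graph_inj).
- by move=> i; rewrite worstP worstP' row_active mulrA.
- by move=> i; rewrite /nominal_term /= row_active mulrA.
- move=> [i j] off_graph; rewrite worstP' /nominal_term /= inactive ?mulr0 //.
  by apply: contraNneq off_graph => ->; rewrite codom_f.
Qed.
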